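(* Let $X$ be a Hausdorff topological group with operations and let $G$ be a regular $G$-method for $X$. If $X$ is $G$-locally compact, then every $G$-closed subset of $X$ is also $G$-locally compact.
   Context: Groups with operations. A category of groups with operations consists of groups (written additively, not necessarily abelian) with a set of operations $\Omega=\Omega_0\cup\Omega_1\cup\Omega_2$ ($\Omega_i$ the $i$-ary operations) and a set of identities including the group laws, such that: $\Omega_0=\{0\}$; $-\in\Omega_1$, $+\in\Omega_2$; with $\Omega_1'=\Omega_1\setminus\{-\}$ and $\Omega_2'=\Omega_2\setminus\{+\}$, if $\star\in\Omega_2'$ then $\star^\circ$, defined by $x\star^\circ y=y\star x$, is in $\Omega_2'$; and for $\star\in\Omega_2'$, $\omega\in\Omega_1'$ the identities $x\star(y+z)=x\star y+x\star z$, $\omega(x+y)=\omega(x)+\omega(y)$, $\omega(x)\star y=\omega(x\star y)$ hold. A morphism of groups with operations is a group homomorphism preserving the operations of $\Omega_1'$ and $\Omega_2'$. A subgroup with operations is a subgroup closed under all operations in $\Omega_1$ and $\Omega_2$. A topological group with operations is such an object with a topology making all operations continuous. $G$-methods. Let $s(X)$ be the set of all sequences in $X$, a group with operations under termwise operations. A $G$-method for $X$ is a morphism of groups with operations $G\colon c_G(X)\to X$ defined on a subgroup with operations $c_G(X)$ of $s(X)$. A sequence $\mathbf{x}$ is $G$-convergent to $\ell$ if $\mathbf{x}\in c_G(X)$ and $G(\mathbf{x})=\ell$; writing $G(\mathbf{x})=\ell$ includes $\mathbf{x}\in c_G(X)$. $G$ is regular if every convergent sequence $\mathbf{x}$ in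 $X$ lies in $c_G(X)$ and $G(\mathbf{x})=\lim\mathbf{x}$. $G$-closed, $G$-open, $G$-compact. A subset $A\subseteq X$ is $G$-closed if whenever $\mathbf{x}$ is a sequence of points of $A$ with $G(\mathbf{x})=\ell$, then $\ell\in A$; it is $G$-open if $X\setminus A$ is $G$-closed. A subset $U\subseteq A$ is $G$-open in $A$ if $U=A\cap V$ for some $G$-open $V\subseteq X$. A subset $A$ is $G$-compact if every sequence of points in $A$ has a subsequence $\mathbf{y}$ with $G(\mathbf{y})=\ell\in A$. A $G$-neighbourhood of $a\in A$ in $A$ is a subset $V\subseteq A$ for which there is $U$, $G$-open in $A$, with $a\in U\subseteq V$. $G$-local compactness. $X$ (respectively a subset $A$ of $X$) is $G$-locally compact if every point has a fundamental system of $G$-compact neighbourhoods: for every point $a$ of $X$ (resp. $A$) and every $U$ containing $a$ that is $G$-open in $X$ (resp. in $A$), there is a $G$-compact $G$-neighbourhood $K$ of $a$ in $X$ (resp. in $A$) with $K\subseteq U$. *)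

(* Defs.v *)
From HB Require Import structures.
From mathcomp Require Import all_boot all_classical.
From mathcomp Require Import topology.

Set Implicit Arguments.
Unset Strict Implicit.
Unset Printing Implicit Defensive.

Local Open Scope classical_set_scope.

(* Groups with operations are written additively in the literature although
   addition need not commute.  Additive structures of the library that satisfy
   the group laws are commutative, so the underlying group is a [groupType] and
   keeps its multiplicative notation: x + y, - x and 0 are x * y, x^-1 and 1. *)

Local Open Scope group_scope.

(* [un_symb] and [bin_symb] are Omega_1' and Omega_2'; the operations 0, -, +
   come from the group structure.  [opp_symb] is the map star |-> star^o. *)
Record signature := Signature {
  un_symb : Type;
  bin_symb : Type;
  opp_symb : bin_symb -> bin_symb }.

Inductive term (S : signature) : Type :=
| TVar of nat
| TOne
| TInv of term S
| TMul of term S & term S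
| TUn of un_symb S & term S
| TBin of bin_symb S & term S & term S.

(* A category of groups with operations is determined by its signature and by
   the identities imposed beyond those shared by all such categories. *)
Record gwo_category := GwoCategory {
  sig_of :> signature;
  identity_of : term sig_of -> term sig_of -> Prop }.

Section Eval.
Variables (S : signature) (X : groupType).
Variables (un : un_symb S -> X -> X) (bin : bin_symb S -> X -> X -> X).
Variable v : nat -> X.

Fixpoint eval (t : term S) : X :=
  match t with
  | TVar i => v i
  | TOne => 1
  | TInv s => (eval s)^-1
  | TMul s1 s2 => eval s1 * eval s2
  | TUn w s => un w (eval s)
  | TBin b s1 s2 => bin b (eval s1) (eval s2)
  end.

End Eval.

HB.mixin Record Group_isGroupWithOps (C : gwo_category) X of Group X := {
  unop : un_symb C -> X -> X;
  binop : bin_symb C -> X -> X -> X;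
  binop_opp : forall b x y, binop (opp_symb b) x y = binop b y x;
  binopMr : forall b x y z, binop b x (y * z) = binop b x y * binop b x z;
  unopM : forall w x y, unop w (x * y) = unop w x * unop w y;
  binop_unl : forall w b x y, binop b (unop w x) y = unop w (binop b x y);
  gwo_identities : forall s t : term C, identity_of s t ->
    forall v : nat -> X, eval unop binop v s = eval unop binop v t }.

#[short(type="groupWithOpsType")]
HB.structure Definition GroupWithOps (C : gwo_category) :=
  {X of Group X & Group_isGroupWithOps C X}.

HB.mixin Record GroupWithOps_isTopological (C : gwo_category) X
    of Topological X & GroupWithOps C X := {
  mulg_continuous : continuous (fun p : X * X => p.1 * p.2);
  invg_continuous : continuous (fun x : X => x^-1);
  unop_continuous : forall w : un_symb C, continuous (fun x : X => unop w x);
  binop_continuous : forall b : bin_symb C,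
    continuous (fun p : X * X => binop b p.1 p.2) }.

#[short(type="topGroupWithOpsType")]
HB.structure Definition TopGroupWithOps (C : gwo_category) :=
  {X of Topological X & GroupWithOps C X & GroupWithOps_isTopological C X}.

Definition gwo_morphism (C : gwo_category) (X Y : groupWithOpsType C)
    (f : X -> Y) : Prop :=
  [/\ forall x y, f (x * y) = f x * f y,
      forall w x, f (unop w x) = unop w (f x)
    & forall b x y, f (binop b x y) = binop b (f x) (f y)].

Record subgwo (C : gwo_category) (X : groupWithOpsType C) := SubGwo {
  subgwo_set :> set X;
  subgwo1 : subgwo_set 1;
  subgwoM : forall x y, subgwo_set x -> subgwo_set y -> subgwo_set (x * y);
  subgwoV : forall x, subgwo_set x -> subgwo_set x^-1;
  subgwo_un : forall w x, subgwo_set x -> subgwo_set (unop w x);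
  subgwo_bin : forall b x y,
    subgwo_set x -> subgwo_set y -> subgwo_set (binop b x y) }.

Section SubObject.
Variables (C : gwo_category) (X : groupWithOpsType C) (H : subgwo X).

Record subgwo_type := SubGwoElt {
  subgwo_val :> X;
  subgwo_valP : subgwo_val \in (H : set X) }.

HB.instance Definition _ := [isSub for subgwo_val].
HB.instance Definition _ := [Choice of subgwo_type by <:].

Let mk (x : X) (Hx : (H : set X) x) : subgwo_type := SubGwoElt (mem_set Hx).
Let valH (x : subgwo_type) : (H : set X) (subgwo_val x) :=
  set_mem (subgwo_valP x).

Definition subgwo_one := mk (subgwo1 H).
Definition subgwo_mul x y := mk (subgwoM (valH x) (valH y)).
Definition subgwo_inv x := mk (subgwoV (valH x)).
Definition subgwo_unop w x := mk (subgwo_un w (valH x)).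
Definition subgwo_binop b x y := mk (subgwo_bin b (valH x) (valH y)).

Fact subgwo_mulA : associative subgwo_mul.
Proof. by move=> x y z; apply: val_inj; exact: mulgA. Qed.
Fact subgwo_mul1 : left_id subgwo_one subgwo_mul.
Proof. by move=> x; apply: val_inj; exact: mul1g. Qed.
Fact subgwo_mulr1 : right_id subgwo_one subgwo_mul.
Proof. by move=> x; apply: val_inj; exact: mulg1. Qed.
Fact subgwo_mulV : left_inverse subgwo_one subgwo_inv subgwo_mul.
Proof. by move=> x; apply: val_inj; exact: mulVg. Qed.
Fact subgwo_mulrV : right_inverse subgwo_one subgwo_inv subgwo_mul.
Proof. by move=> x; apply: val_inj; exact: mulgV. Qed.

HB.instance Definition _ := isGroup.Build subgwo_type
  subgwo_mulA subgwo_mul1 subgwo_mulr1 subgwo_mulV subgwo_mulrV.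

Fact subgwo_binop_opp b x y :
  subgwo_binop (opp_symb b) x y = subgwo_binop b y x.
Proof. by apply: val_inj; exact: binop_opp. Qed.
Fact subgwo_binopMr b x y z :
  subgwo_binop b x (y * z) = subgwo_binop b x y * subgwo_binop b x z.
Proof. by apply: val_inj; exact: binopMr. Qed.
Fact subgwo_unopM w x y :
  subgwo_unop w (x * y) = subgwo_unop w x * subgwo_unop w y.
Proof. by apply: val_inj; exact: unopM. Qed.
Fact subgwo_binop_unl w b x y :
  subgwo_binop b (subgwo_unop w x) y = subgwo_unop w (subgwo_binop b x y).
Proof. by apply: val_inj; exact: binop_unl. Qed.

Fact subgwo_eval (v : nat -> subgwo_type) (t : term C) :
  subgwo_val (eval subgwo_unop subgwo_binop v t) =
  eval unop binop (fun i => subgwo_val (v i)) t.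
Proof.
by elim: t => //= [s <-|s <- t <-|w s <-|b s <- t <-].
Qed.

Fact subgwo_identities (s t : term C) : identity_of s t ->
  forall v : nat -> subgwo_type,
    eval subgwo_unop subgwo_binop v s = eval subgwo_unop subgwo_binop v t.
Proof.
move=> st v; apply: val_inj.
by rewrite /= !subgwo_eval; exact: gwo_identities.
Qed.

HB.instance Definition _ := Group_isGroupWithOps.Build C subgwo_type
  subgwo_binop_opp subgwo_binopMr subgwo_unopM subgwo_binop_unl
  subgwo_identities.

End SubObject.

Section Sequences.
Variables (C : gwo_category) (X : groupWithOpsType C).

Definition seqs := nat -> X.
HB.instance Definition _ := Choice.on seqs.

Definition seqs_one : seqs := fun=> 1.
Definition seqs_mul (x y : seqs) : seqs := fun n => x n * y n.
Definition seqs_inv (x : seqs) : seqs := fun n => (x n)^-1.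
Definition seqs_unop w (x : seqs) : seqs := fun n => unop w (x n).
Definition seqs_binop b (x y : seqs) : seqs := fun n => binop b (x n) (y n).

Fact seqs_mulA : associative seqs_mul.
Proof. by move=> x y z; apply/funext => n; exact: mulgA. Qed.
Fact seqs_mul1 : left_id seqs_one seqs_mul.
Proof. by move=> x; apply/funext => n; exact: mul1g. Qed.
Fact seqs_mulr1 : right_id seqs_one seqs_mul.
Proof. by move=> x; apply/funext => n; exact: mulg1. Qed.
Fact seqs_mulV : left_inverse seqs_one seqs_inv seqs_mul.
Proof. by move=> x; apply/funext => n; exact: mulVg. Qed.
Fact seqs_mulrV : right_inverse seqs_one seqs_inv seqs_mul.
Proof. by move=> x; apply/funext => n; exact: mulgV. Qed.

HB.instance Definition _ := isGroup.Build seqs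
  seqs_mulA seqs_mul1 seqs_mulr1 seqs_mulV seqs_mulrV.

Fact seqs_binop_opp b x y : seqs_binop (opp_symb b) x y = seqs_binop b y x.
Proof. by apply/funext => n; exact: binop_opp. Qed.
Fact seqs_binopMr b x y z :
  seqs_binop b x (y * z) = seqs_binop b x y * seqs_binop b x z.
Proof. by apply/funext => n; exact: binopMr. Qed.
Fact seqs_unopM w (x y : seqs) :
  seqs_unop w (x * y) = seqs_unop w x * seqs_unop w y.
Proof. by apply/funext => n; exact: unopM. Qed.
Fact seqs_binop_unl w b x y :
  seqs_binop b (seqs_unop w x) y = seqs_unop w (seqs_binop b x y).
Proof. by apply/funext => n; exact: binop_unl. Qed.

Fact seqs_eval (v : nat -> seqs) (t : term C) n :
  eval seqs_unop seqs_binop v t n = eval unop binop (fun i => v i n) t.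
Proof.
elim: t => //= [s <- //|s <- t <- //|w s <- //|b s <- t <- //].
Qed.

Fact seqs_identities (s t : term C) : identity_of s t ->
  forall v : nat -> seqs,
    eval seqs_unop seqs_binop v s = eval seqs_unop seqs_binop v t.
Proof.
move=> st v; apply/funext => n.
by rewrite !seqs_eval; exact: gwo_identities.
Qed.

HB.instance Definition _ := Group_isGroupWithOps.Build C seqs
  seqs_binop_opp seqs_binopMr seqs_unopM seqs_binop_unl seqs_identities.

End Sequences.

Record gmethod (C : gwo_category) (X : groupWithOpsType C) := GMethod {
  gdom : subgwo (seqs X);
  gfun :> subgwo_type gdom -> X;
  gfun_morphism : gwo_morphism gfun }.

(* The assertion G(x) = l, which includes that x belongs to c_G(X). *)
Definition gconverges (C : gwo_category) (X : groupWithOpsType C)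
    (G : gmethod X) (x : nat -> X) (l : X) : Prop :=
  exists u : subgwo_type (gdom G), subgwo_val u = x /\ G u = l.

Definition gregular (C : gwo_category) (X : topGroupWithOpsType C)
    (G : gmethod X) : Prop :=
  forall (x : nat -> X) (l : X), x @ \oo --> l -> gconverges G x l.

Section GTopology.
Variables (C : gwo_category) (X : groupWithOpsType C) (G : gmethod X).
Implicit Types A U V K : set X.

Definition gclosed A : Prop :=
  forall (x : nat -> X) (l : X),
    (forall n, A (x n)) -> gconverges G x l -> A l.

Definition gopen A : Prop := gclosed (~` A).

Definition gopen_in A U : Prop := exists2 V, gopen V & U = A `&` V.

Definition gcompact A : Prop :=
  forall x : nat -> X, (forall n, A (x n)) ->
    exists f : nat -> nat, {homo f : m n / (m < n)%N} /\
      exists2 l, gconverges G (x \o f) l & A l.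

Definition gnbhd_in A (a : X) V : Prop :=
  V `<=` A /\ exists U, [/\ gopen_in A U, U a & U `<=` V].

(* The space X itself is the case A = setT. *)
Definition glocally_compact A : Prop :=
  forall a U, A a -> gopen_in A U -> U a ->
    exists K, [/\ gcompact K, gnbhd_in A a K & K `<=` U].

End GTopology.

(* Main.v *)
Require Import Defs.
From mathcomp Require Import all_boot all_classical.
From mathcomp Require Import topology.

(** Intersecting with a G-closed set A turns a G-compact G-neighbourhood in the
    whole space into one in A: the G-limit of a sequence of points of A stays in
    A ([gcompact_setI_gclosed]), and the trace on A of a G-neighbourhood is one
    in A ([gnbhd_in_trace]).  An open set of A around a is the trace of some
    G-open V, so the traces of the G-compact neighbourhoods contained in V
    form the required fundamental system at a. *)

Local Open Scope classical_set_scope.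

(** The subsequence provided by G-compactness of K consists of points of A, so
    its G-limit, which lies in K, lies in A as well. *)
Lemma gcompact_setI_gclosed (C : gwo_category) (X : groupWithOpsType C)
    (G : gmethod X) (A K : set X) :
  gclosed G A -> gcompact G K -> gcompact G (A `&` K).
Proof.
move=> hA hK x AKx.
have [f [f_incr [l xf_l Kl]]] := hK x (fun n => proj2 (AKx n)).
exists f; split=> //; exists l => //; split=> //.
by apply: hA xf_l => n; exact: proj1 (AKx (f n)).
Qed.

Lemma gopen_in_setT (C : gwo_category) (X : groupWithOpsType C)
    (G : gmethod X) (V : set X) :
  gopen_in G [set: X] V <-> gopen G V.
Proof.
split=> [[W oW ->]|oV]; first by rewrite setTI.
by exists V => //; rewrite setTI.
Qed.

Lemma gnbhd_in_trace (C : gwo_category) (X : groupWithOpsType C)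
    (G : gmethod X) (A K : set X) (a : X) :
  A a -> gnbhd_in G [set: X] a K -> gnbhd_in G A a (A `&` K).
Proof.
move=> Aa [_ [W [/gopen_in_setT oW Wa WK]]]; split; first exact: subIsetl.
by exists (A `&` W); split; [exists W | split | exact: setIS].
Qed.

Theorem theorem3p10 (C : gwo_category) (X : topGroupWithOpsType C)
    (G : gmethod X) (hX : hausdorff_space X) (hG : gregular G)
    (hlc : glocally_compact G [set: X]%classic)
    (A : set X) (hA : gclosed G A) :
  glocally_compact G A.
Proof.
move=> a _ Aa [V oV ->] [_ Va].
move/gopen_in_setT: oV => oV.
have [K [cK nK KV]] := hlc a V I oV Va.
exists (A `&` K); split; last exact: setIS.
- exact: gcompact_setI_gclosed.
- exact: gnbhd_in_trace.
Qed.
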